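(* Let $p\ge 4$ be even, $\alpha>0$, $\kappa>0$ and $\rho\in(0,1)$ be constants, let $d(n)$ be a positive-integer-valued sequence, and for each $n$ let $C$ be a circuit in $\mathcal{C}_p(n,n^\alpha,d(n),\rho)$. Then for all sufficiently large $n$, the probability that no pair $(J_t,J_{t+1})$, $0\le t\le n^p-1$, of the interpolation path is $\kappa$-bad is at least $\exp\left(-(\log n)^{1.2\,d(n)}\right)$.
   Context: A $p$-tensor is $J\in\{\pm1\}^{n^p}$ indexed by $[n]^p$; $\langle J,\sigma\rangle=\sum_{i_1,\dots,i_p}J_{i_1,\dots,i_p}\sigma_{i_1}\cdots\sigma_{i_p}$ for $\sigma\in\{\pm1\}^n$. Boolean circuits are directed acyclic graphs with $n^p$ inputs, $n$ outputs and gates $\vee,\wedge,\neg$ (values encoded as $\pm1$), computing $C:\{\pm1\}^{n^p}\to\{\pm1\}^n$; size = number of gates, depth = length of the longest directed path. $\mathcal{C}_p(n,s(n),d(n),\rho)$ is the family of such circuits of size at most $s(n)$ and depth at most $d(n)$ such that $\langle J,C(J)\rangle\ge\rho\max_\sigma\langle J,\sigma\rangle$ for every $J$ with $\max_\sigma\langle J,\sigma\rangle\ge0$. A pair $(J_1,J_2)$ of tensors differing in at most one entry is $\kappa$-bad if $\|C(J_1)-C(J_2)\|_2^2\ge\kappa n$. Interpolation path: $J_0$ has i.i.d. uniform $\pm1$ entries; $I_1,\dots,I_{n^p}$ is a uniformly random ordering of $[n]^p$ independent of $J_0$; $J_t$ is obtained from $J_{t-1}$ by replacing entry $I_t$ by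 an independent uniform $\pm1$ variable. The probability is over $J_0$, the order and the resamplings. *)

(* Defs.v *)
From mathcomp Require Import all_boot all_order all_algebra.
From mathcomp Require Import reals.

Set Implicit Arguments.
Unset Strict Implicit.
Unset Printing Implicit Defensive.

Import Order.TTheory GRing.Theory Num.Theory.
Local Open Scope ring_scope.

(* Booleans stand for the values +1 and -1 throughout, with true ~ +1.  The
   opposite convention would only exchange the roles of the two gates And and
   Or. *)
Definition spin (R : realType) (b : bool) : R := if b then 1 else -1.

Inductive gate_op := And | Or | Not.

(* Boolean circuits of unbounded fan-in, as directed acyclic graphs.  [T]
   indexes the inputs and [O] the outputs; the nodes are the inputs and the
   gates, the inputs are exactly the sources, and an output may be read at any
   node. *)
Section Circuits.
Variables T O : finType.

Definition edge (G : finType) (fanin : G -> {set T + G}) : rel (T + G)%type :=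
  fun u v => if v is inr g then u \in fanin g else false.

Record circuit := Circuit {
  gate : finType;
  op : gate -> gate_op;
  fanin : gate -> {set T + gate};
  output : O -> (T + gate)%type;
  fanin_neq0 : forall g, fanin g != set0;
  fanin_Not : forall g, op g = Not -> #|fanin g| = 1%N;
  acyclic : forall u v, edge fanin u v -> ~~ connect (edge fanin) v u
}.

Variable C : circuit.
Let node := (T + gate C)%type.
Let wire : rel node := edge (@fanin C).

Definition circuit_size : nat := #|gate C|.

(* Directed paths in a finite acyclic graph have fewer edges than there are
   nodes, so the bounded maximum is the maximum over all of them; see
   [circuit_depthP]. *)
Definition circuit_depth : nat :=
  (\max_(k < #|{: node}| |
         [exists u : node, exists s : k.-tuple node, path wire u s]) k)%N.

Definition node_value (x : {ffun T -> bool}) (v : {ffun gate C -> bool})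
    (u : node) : bool :=
  match u with inl i => x i | inr g => v g end.

Definition gate_update (x : {ffun T -> bool}) (v : {ffun gate C -> bool}) :
    {ffun gate C -> bool} :=
  [ffun g => match op g with
    | And => [forall u in fanin g, node_value x v u]
    | Or => [exists u in fanin g, node_value x v u]
    | Not => [exists u in fanin g, ~~ node_value x v u]
    end].

(* By acyclicity, #|gate C| rounds of updates reach the unique assignment of
   values to the gates that is consistent with all of them; see
   [gate_valueP]. *)
Definition gate_value (x : {ffun T -> bool}) : {ffun gate C -> bool} :=
  iter #|gate C| (gate_update x) [ffun=> false].

Definition circuit_eval (x : {ffun T -> bool}) : {ffun O -> bool} :=
  [ffun o => node_value x (gate_value x) (output C o)].

Let anc (g : gate C) : {set gate C} := [set h | connect wire (inr h) (inr g)].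

Let anc_lt g h : inr h \in fanin g -> (#|anc h| < #|anc g|)%N.
Proof.
move=> hg; have wgh : wire (inr h) (inr g) by [].
apply: proper_card; apply/properP; split.
  apply/subsetP => k; rewrite !inE => kh.
  by apply: connect_trans kh _; apply: connect1.
by exists g; rewrite !inE ?connect0 //; apply: (acyclic wgh).
Qed.

Let gate_update_agree x (v w : {ffun gate C -> bool}) g :
  (forall h, inr h \in fanin g -> v h = w h) ->
  gate_update x v g = gate_update x w g.
Proof.
move=> vw; have E u : u \in fanin g -> node_value x v u = node_value x w u.
  by case: u => //= h; apply: vw.
by rewrite !ffunE; case: (op g); [apply: eq_forallb | apply: eq_existsb
  | apply: eq_existsb] => u; case: (boolP (u \in fanin g)) => //= /E ->.
Qed.

Let iter_agree x w : gate_update x w = w -> forall k v g, (#|anc g| <= k)%N ->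
  iter k (gate_update x) v g = w g.
Proof.
move=> fw; elim=> [|k IHk] v g.
  by rewrite leqn0 cards_eq0 => /eqP/setP/(_ g); rewrite !inE connect0.
move=> gk; rewrite iterS -[in RHS]fw; apply: gate_update_agree => h hg.
by apply: IHk; rewrite -ltnS; apply: leq_trans (anc_lt hg) gk.
Qed.

Let iter_stable x v : forall k g, (#|anc g| <= k)%N ->
  iter k.+1 (gate_update x) v g = iter k (gate_update x) v g.
Proof.
elim=> [|k IHk] g.
  by rewrite leqn0 cards_eq0 => /eqP/setP/(_ g); rewrite !inE connect0.
move=> gk; rewrite iterS [in RHS]iterS; apply: gate_update_agree => h hg.
by apply: IHk; rewrite -ltnS; apply: leq_trans (anc_lt hg) gk.
Qed.

Lemma gate_valueP x v : (gate_update x v = v) <-> (v = gate_value x).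
Proof.
split=> [fv | ->].
  by apply/ffunP => g; rewrite /gate_value (iter_agree fv) ?max_card.
by apply/ffunP => g; rewrite /gate_value -iterS iter_stable ?max_card.
Qed.

Let path_uniq u s : path wire u s -> uniq (u :: s).
Proof.
elim: s u => //= v s IHs u /andP[uv vs]; have /= -> := IHs v vs.
rewrite andbT; apply/negP => us.
have /negP[] := acyclic uv.
by apply: (path_connect vs).
Qed.

Lemma circuit_depthP m :
  reflect (forall u s, path wire u s -> (size s <= m)%N) (circuit_depth <= m)%N.
Proof.
rewrite /circuit_depth; apply: (iffP (bigmax_leqP _ _ _)) => [le_m u s us |
  le_m k /existsP[u /existsP[s us]]].
  have lt_s : (size s < #|{: node}|)%N.
    by rewrite -[(size s).+1]/(size (u :: s)) -(card_uniqP (path_uniq us))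
               max_card.
  apply: (le_m (Ordinal lt_s)); apply/existsP; exists u; apply/existsP.
  by exists (in_tuple s).
by rewrite -(size_tuple s); apply: le_m us.
Qed.

End Circuits.

Definition multi_index (n p : nat) : finType := p.-tuple 'I_n.

Definition tensor (n p : nat) : finType := {ffun multi_index n p -> bool}.

Definition pairing (R : realType) (n p : nat) (J : tensor n p)
    (sigma : {ffun 'I_n -> bool}) : R :=
  \sum_(i : multi_index n p)
    spin R (J i) * \prod_(k < p) spin R (sigma (tnth i k)).

(* The iterated maximum is started from one of the values being compared, so
   that it can be negative. *)
Definition max_pairing (R : realType) (n p : nat) (J : tensor n p) : R :=
  \big[Num.max/pairing R J [ffun=> true]]_(sigma : {ffun 'I_n -> bool})
    pairing R J sigma.

Definition circuit_class (R : realType) (p n : nat) (s : R) (d : nat) (rho : R)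
    (C : circuit (multi_index n p) 'I_n) : Prop :=
  [/\ (circuit_size C)%:R <= s,
      (circuit_depth C <= d)%N &
      forall J : tensor n p, 0 <= max_pairing R J ->
        rho * max_pairing R J <= pairing R J (circuit_eval C J)].

Definition sqdist (R : realType) (n : nat) (x y : {ffun 'I_n -> bool}) : R :=
  \sum_(i < n) (spin R (x i) - spin R (y i)) ^+ 2.

Definition bad (R : realType) (p n : nat) (C : circuit (multi_index n p) 'I_n)
    (kappa : R) (J1 J2 : tensor n p) : bool :=
  (#|[set i | J1 i != J2 i]| <= 1)%N &&
  (kappa * n%:R <= sqdist R (circuit_eval C J1) (circuit_eval C J2)).

(* A duplicate-free n ^ p-tuple of indices lists [n]^p exactly once. *)
Definition ordering (n p : nat) : finType :=
  {s : (n ^ p).-tuple (multi_index n p) | uniq s}.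

(* The randomness of the interpolation path: the initial tensor, the order of
   the entries, and the resampled values, the t-th of which goes to the t-th
   entry in the order.  Under the uniform probability on this product they are
   independent and uniform, as are all the coordinates of the first and the
   third. *)
Definition sample (n p : nat) : finType :=
  (tensor n p * ordering n p * (n ^ p).-tuple bool)%type.

Definition prob (R : realType) (W : finType) (E : {set W}) : R :=
  #|E|%:R / #|W|%:R.

Definition resample (n p : nat) (J : tensor n p) (ib : multi_index n p * bool) :
    tensor n p :=
  [ffun i => if i == ib.1 then ib.2 else J i].

Definition interpolation (n p : nat) (w : sample n p) (t : nat) : tensor n p :=
  let: (J0, order, X) := w in
  foldl (@resample n p) J0 (take t (zip (val order) X)).

Definition no_bad_pair (R : realType) (p n : nat)
    (C : circuit (multi_index n p) 'I_n) (kappa : R) : {set sample n p} :=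
  [set w | [forall t : 'I_(n ^ p),
     ~~ bad C kappa (interpolation w t) (interpolation w t.+1)]].

(* Main.v *)
Require Import Defs.
From mathcomp Require Import all_boot all_order all_algebra.
From mathcomp Require Import reals sequences exp.
From mathcomp Require Import ring lra zify.

Set Implicit Arguments.
Unset Strict Implicit.
Unset Printing Implicit Defensive.

Import Order.TTheory GRing.Theory Num.Theory.
Local Open Scope ring_scope.

(* Tilt the path so that it never crosses a bad edge: every tensor of the tilted
   path is still uniform, and each bad edge that is avoided costs a factor 2.
   Hence no pair is bad with probability at least 2^-b, where b is the expected
   number of bad edges at a uniform tensor, and b <= (4 / kappa) I if I bounds
   the average sensitivity of every output.  For a circuit of depth d, with
   w ~ log2 (size * number of inputs), I <= (34 w)^(d-1) 2w: a random
   restriction with star probability 1 / (16 w + 1) divides the average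
   sensitivity by 16 w + 1 and, by the switching lemma, except with probability
   2^-w per gate, it brings the certificate complexity of one more level of
   gates down to w; a gate of the last level has w-certificates for one of its
   values, hence average sensitivity at most 2w. *)

(** * Certificates and random restrictions *)

Section Cube.
Variable T : finType.
Implicit Types (f : {ffun T -> bool} -> bool) (x y z : {ffun T -> bool}).
Implicit Types (r : {ffun T -> option bool}) (i : T) (D S : {set T}).

Definition flip i x : {ffun T -> bool} :=
  [ffun j => if j == i then ~~ x j else x j].

(** Divided by the number of points this is the average sensitivity of [f]; every edge is counted
    from both ends. *)
Definition boundary f : nat :=
  #|[set xi : {ffun T -> bool} * T | f xi.1 != f (flip xi.2 xi.1)]|.

Definition agree S x y := [forall i in S, x i == y i].

Definition cert_at b f x S := [forall y, agree S x y ==> (f y == b)].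

(* For [b = true]: [f] is a DNF of width [w]; for [b = false]: a CNF. *)
Definition cert b w f :=
  [forall x, (f x == b) ==>
     [exists S : {set T}, (#|S| <= w)%N && cert_at b f x S]].

(* In a restriction, [None] is a star. *)
Definition fill r x : {ffun T -> bool} := [ffun i => odflt (x i) (r i)].

Definition upd r i (a : option bool) : {ffun T -> option bool} :=
  [ffun j => if j == i then a else r j].

Lemma flipK i : involutive (flip i).
Proof.
by move=> x; apply/ffunP => j; rewrite !ffunE; case: eqP => // _; rewrite negbK.
Qed.

Lemma agreeP S x y : reflect {in S, x =1 y} (agree S x y).
Proof. by apply: (iffP forall_inP) => H i /H /eqP. Qed.

Lemma certP b w f :
  reflect (forall x, f x = b -> exists2 S : {set T}, (#|S| <= w)%N &
             forall y, {in S, x =1 y} -> f y = b)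
          (cert b w f).
Proof.
apply: (iffP forallP) => H x.
  move=> fx; have:= H x; rewrite fx eqxx => /existsP[S /andP[wS /forallP HS]].
  by exists S => // y /agreeP xy; have:= HS y; rewrite xy => /eqP.
apply/implyP => /eqP /H[S wS HS]; apply/existsP; exists S; rewrite wS.
by apply/forallP => y; apply/implyP => /agreeP /HS ->.
Qed.

Lemma cert_fill b w f r : cert b w f -> cert b w (f \o fill r).
Proof.
move=> /certP cf; apply/certP => x /= /cf[S wS HS]; exists S => // y xy.
by apply: HS => i iS; rewrite !ffunE xy.
Qed.

Lemma certN b w f : cert (~~ b) w (fun x => ~~ f x) = cert b w f.
Proof.
have E x : (~~ f x == ~~ b) = (f x == b) by case: (f x); case: b.
apply: eq_forallb => x; rewrite E; congr (_ ==> _).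
by apply: eq_existsb => S; congr (_ && _); apply: eq_forallb => y; rewrite E.
Qed.

Lemma boundaryE f :
  boundary f = (\sum_x \sum_i (f x != f (flip i x)))%N.
Proof.
rewrite /boundary -sum1_card pair_big /= big_mkcond /=.
by apply: eq_bigr => -[x i] _; rewrite inE /=; case: ifP.
Qed.

Lemma boundary_le f : (boundary f <= #|{ffun T -> bool}| * #|T|)%N.
Proof. by rewrite -card_prod max_card. Qed.

(** Exactly one end of a boundary edge has value [b], hence the factor 2; at that end every
    sensitive coordinate lies in the certificate. *)
Lemma boundary_cert b w f : cert b w f ->
  (boundary f <= #|{ffun T -> bool}| * (2 * w))%N.
Proof.
move=> /certP cf; pose g x i := (f x != f (flip i x)).
have E : boundary f = (2 * \sum_x \sum_i ((f x == b) && g x i))%N.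
  rewrite boundaryE mul2n -addnn.
  rewrite (eq_bigr (fun x => (\sum_i ((f x == b) && g x i) +
     \sum_i ((f (flip i x) == b) && g x i))%N)); last first.
    move=> x _; rewrite -big_split; apply: eq_bigr => i _ /=.
    by rewrite /g; case: (f x); case: (f _); case: b {cf}.
  rewrite big_split /=; congr addn.
  rewrite exchange_big [RHS]exchange_big /=; apply: eq_bigr => i _.
  rewrite (reindex_inj (inv_inj (flipK i))) /=; apply: eq_bigr => x _.
  by rewrite /g flipK; case: (f x); case: (f (flip i x)).
rewrite E mulnCA leq_mul2l /= -[leqRHS]sum_nat_const big_mkcond.
rewrite [leqRHS]big_mkcond; apply: leq_sum => x _ /=.
case: (eqVneq (f x) b) => [fx | _]; last by rewrite big1.
have [S wS HS] := cf x fx; apply: leq_trans wS; rewrite -sum1_card big_mkcond.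
rewrite [leqRHS]big_mkcond; apply: leq_sum => i _ /=.
case: ifP => iS; first exact: leq_b1.
rewrite /g fx (HS (flip i x)) ?eqxx // => j jS; rewrite ffunE.
by case: eqP => // ji; rewrite -ji jS in iS.
Qed.

Lemma fill_flip r i x :
  fill r (flip i x) = if r i is None then flip i (fill r x) else fill r x.
Proof.
apply/ffunP => j; case E: (r i) => [b|]; rewrite !ffunE.
  by case: eqP => // ->; rewrite E.
by case: eqP => // ->; rewrite E.
Qed.

End Cube.

Section Restrictions.
Variables (F : realFieldType) (T : finType) (m : nat).
Implicit Types (f : {ffun T -> bool} -> bool) (x y z : {ffun T -> bool}).
Implicit Types (r : {ffun T -> option bool}) (i : T) (D S : {set T}).

(** A star has probability 1 / (2m + 1) and each bit m / (2m + 1), so that fixing a star multiplies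
    the weight by exactly [m]. *)
Definition star_weight (a : option bool) : F :=
  (if a is Some _ then m%:R else 1) / (2 * m + 1)%:R.

Definition weight r : F := \prod_i star_weight (r i).

Let den_neq0 : (2 * m + 1)%:R != 0 :> F.
Proof. by rewrite pnatr_eq0 addn1. Qed.

Lemma big_option_bool (g : option bool -> F) :
  \sum_a g a = g None + (g (Some true) + g (Some false)).
Proof.
rewrite (bigD1 None) //= (bigD1 (Some true)) //= (bigD1 (Some false)) //=.
by rewrite big1 ?addr0 // => -[[]|].
Qed.

Lemma weight_ge0 r : 0 <= weight r.
Proof. by apply: prodr_ge0 => i _; case: (r i) => [a|]; rewrite divr_ge0. Qed.

Lemma sum_weight : \sum_r weight r = 1.
Proof.
rewrite /weight -(bigA_distr_bigA (fun _ => star_weight)).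
rewrite big1 // => i _; rewrite big_option_bool /star_weight.
by move: den_neq0; rewrite natrD natrM => ?; field.
Qed.

Lemma weight_upd r i b : r i = None -> weight (upd r i (Some b)) = m%:R * weight r.
Proof.
move=> ri; rewrite /weight (bigD1 i) //= [in RHS](bigD1 i) //= ffunE eqxx ri.
rewrite mulrA; congr (_ * _); first by rewrite /star_weight mul1r.
by apply: eq_bigr => j /negPf ji; rewrite ffunE ji.
Qed.

Lemma weight_upd_some r i a b : r i = Some a -> weight (upd r i (Some b)) = weight r.
Proof.
move=> ri; rewrite /weight; apply: eq_bigr => j _; rewrite ffunE.
by case: eqP => // ->; rewrite ri.
Qed.

(* [fill r x] is uniform, and independent of whether [r i] is a star. *)
Lemma fill_uniform i y :
  \sum_(r : {ffun T -> option bool} | r i == None)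
    \sum_(x | fill r x == y) weight r = (2 * m + 1)%:R^-1.
Proof.
pose c (a : option bool) b j : F := (odflt b a == y j)%:R.
pose s (a : option bool) j : F := ((j == i) ==> (a == None))%:R.
(* The sum factors over the coordinates: [s] imposes the star at [i], where the factor is 1 / (2m +
   1); all other factors are 1. *)
transitivity (\sum_(r : {ffun T -> option bool})
  \prod_j (star_weight (r j) * s (r j) j * \sum_b c (r j) b j)).
  rewrite big_mkcond; apply: eq_bigr => r _.
  rewrite big_split /= big_split /= bigA_distr_bigA /= -/(weight r).
  have -> : \prod_j s (r j) j = (r i == None)%:R.
    rewrite (bigD1 i) //= /s eqxx big1 ?mulr1 // => j /negPf -> //.
  case: eqP => _; last by rewrite mulr0 mul0r.
  rewrite mulr1 mulr_sumr big_mkcond /=; apply: eq_bigr => x _.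
  have -> : \prod_j c (r j) (x j) j = (fill r x == y)%:R.
    case: eqP => [e | ne].
      by rewrite big1 // => j _; rewrite /c -e ffunE eqxx.
    apply/eqP; rewrite prodf_seq_eq0; apply/hasP.
    have /existsP[j Hj] : [exists j, fill r x j != y j].
      rewrite -negb_forall; apply/negP => /forallP H; apply: ne; apply/ffunP => j.
      exact/eqP.
    exists j; first exact: mem_index_enum.
    by rewrite ffunE in Hj; rewrite /= /c (negPf Hj).
  by case: eqP; rewrite (mulr1, mulr0).
rewrite -(bigA_distr_bigA (fun j a => star_weight a * s a j * \sum_b c a b j)).
rewrite (bigD1 i) //= [X in _ * X]big1 => [|j /negPf ji]; last first.
  rewrite /c /s ji !big_option_bool !big_bool /star_weight /=.
  move: den_neq0; rewrite natrD natrM => ?.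
  by case: (y j); rewrite /=; field.
rewrite mulr1 !big_option_bool !big_bool /c /s /star_weight eqxx /=.
move: den_neq0; rewrite natrD natrM => ?.
by case: (y i); rewrite /=; field.
Qed.

End Restrictions.

Lemma head_filter_sub (A : Type) (x0 : A) (P Q : pred A) s :
  subpred Q P -> Q (head x0 (filter P s)) ->
  head x0 (filter Q s) = head x0 (filter P s).
Proof.
move=> QP; elim: s => //= a s IHs; case Pa: (P a) => /=; first by move=> ->.
by case Qa: (Q a); [rewrite (QP _ Qa) in Pa | exact: IHs].
Qed.

Section BoundaryFill.
Variables (F : realFieldType) (T : finType) (m : nat).

(** A pair (x, i) counts only if [i] is a star of [r], and then [fill r x] is uniform by
    [fill_uniform]. *)
Lemma sum_boundary_fill (f : {ffun T -> bool} -> bool) :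
  \sum_r weight F m r * (boundary (f \o fill r))%:R =
  (boundary f)%:R / (2 * m + 1)%:R.
Proof.
pose h i y : F := (f y != f (flip i y))%:R.
transitivity (\sum_i \sum_(r : {ffun T -> option bool} | r i == None)
                \sum_x weight F m r * h i (fill r x)).
  under [RHS]eq_bigr => i _ do rewrite big_mkcond.
  rewrite exchange_big /=; apply: eq_bigr => r _.
  rewrite boundaryE exchange_big natr_sum mulr_sumr; apply: eq_bigr => i _.
  rewrite natr_sum mulr_sumr /=.
  transitivity (\sum_x if r i == None then weight F m r * h i (fill r x) else 0).
    apply: eq_bigr => x _; rewrite fill_flip; case: (r i) => [b|] //=.
    by rewrite eqxx mulr0.
  by case: (r i == None); rewrite // big1.
rewrite boundaryE exchange_big natr_sum mulr_suml; apply: eq_bigr => i _.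
rewrite natr_sum mulr_suml /=.
under eq_bigr => r _ do rewrite (partition_big (fill r) predT) //=.
rewrite exchange_big /=; apply: eq_bigr => y _.
rewrite -(fill_uniform _ _ i y) mulr_sumr; apply: eq_bigr => r _.
by rewrite mulr_sumr; apply: eq_bigr => x /eqP ->; rewrite mulrC.
Qed.

End BoundaryFill.

(** * The switching lemma *)

Section Switching.
Variables (F : realFieldType) (T : finType) (m w : nat).
Variables (f : {ffun T -> bool} -> bool) (S : {ffun T -> bool} -> {set T}).
Hypothesis S_size : forall z, f z -> (#|S z| <= w)%N.
Hypothesis S_cert : forall z (y : {ffun T -> bool}), f z -> {in S z, z =1 y} -> f y.
Variable (i0 : T).
Implicit Types (x y z : {ffun T -> bool}) (r : {ffun T -> option bool}).
Implicit Types (i : T) (D R : {set T}) (c : seq ('I_w * bool * bool)).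

(* The terms of the DNF are the [z] with [f z], and [z] stands for the
   conjunction of its literals on [S z]; it is alive if not falsified by [r]. *)
Definition alive r z := [forall i in S z, r i != Some (~~ z i)].

(** The enumeration order is fixed, so that encoder and decoder agree on the first term; the default
    is reached only if no term is alive. *)
Definition first_alive r :=
  head [ffun=> true] [seq z <- enum {ffun T -> bool} | f z && alive r z].

(* Razborov's encoding of a restriction whose minimal 0-certificate is long: its
   variables are met term by term, each term being the first one alive once the
   previous ones are falsified, and [r] sets them so as to satisfy these terms.
   A triple of the code gives the position of a variable in the current term
   [z], its value in the certificate, and whether it is the last one of [z]. *)
Fixpoint decode r z c :=
  if c is (j, b, e) :: c' then
    let i := nth i0 (enum (S z)) j in
    let r1 := upd r i (Some b) in
    upd (decode r1 (if e then first_alive r1 else z) c') i None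
  else r.

Definition minimal_cert r x R :=
  (forall y : {ffun T -> bool}, {in R, x =1 y} -> ~~ f (fill r y)) /\
  (forall D, D \proper R -> exists2 y : {ffun T -> bool}, {in D, x =1 y} & f (fill r y)).

(** By minimality the empty set is no certificate, so some term is alive. A first term disjoint from
    [R] could be satisfied by an input that agrees with [x] on [R], against the certificate. *)
Lemma first_alive_hits r x R : minimal_cert r x R -> R != set0 ->
  [/\ f (first_alive r), alive r (first_alive r) &
      exists2 i, i \in S (first_alive r) & i \in R].
Proof.
move=> [Rcert Rmin] R0; have [|y0 _ fy0] := Rmin set0; first by rewrite proper0.
pose L := [seq z <- enum {ffun T -> bool} | f z && alive r z].
have : first_alive r \in L.
  have : fill r y0 \in L.
    rewrite mem_filter fy0 mem_enum andbT /=; apply/forall_inP => i _.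
    by rewrite ffunE; case: (r i) => [[]|].
  by rewrite /first_alive -/L; case: L => //= a L _; rewrite inE eqxx.
rewrite mem_filter => /andP[/andP[fz az] _]; split=> //.
set z := first_alive r in fz az *.
case: (pickP [pred i in S z | i \in R]) => [i /andP[/= iS iR] | noi]; first by exists i.
pose y : {ffun T -> bool} := [ffun i => if i \in R then x i else z i].
have /negP[] : ~~ f (fill r y).
  by apply: Rcert => i iR; rewrite ffunE iR.
apply: (S_cert fz) => i iS; rewrite !ffunE.
have := forall_inP az i iS; have := noi i; rewrite /= iS /= => ->.
by case: (r i) => [b|] //=; case: b; case: (z i).
Qed.

Lemma first_alive_stable r r' :
  (forall z, alive r' z -> alive r z) -> f (first_alive r) ->
  alive r' (first_alive r) -> first_alive r' = first_alive r.
Proof.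
move=> r'r fz az; apply: head_filter_sub => [z /andP[-> /r'r]//|].
by apply/andP.
Qed.

(** Setting stars can only kill terms, and the first one survives by hypothesis; the decoder thus
    finds it from [r'] alone. *)
Lemma first_alive_extend r r' x R : {in R, forall i, r i = None} ->
  minimal_cert r x R -> R != set0 -> {in ~: R, r' =1 r} ->
  (forall i, i \in S (first_alive r) -> i \in R ->
     r' i != Some (~~ first_alive r i)) ->
  first_alive r' = first_alive r.
Proof.
move=> rR Rmin R0 r'r r'S; have [fz az _] := first_alive_hits Rmin R0.
apply: first_alive_stable => // [z a'z|]; apply/forall_inP => i iS.
  case iR: (i \in R); first by rewrite rR.
  by rewrite -r'r ?inE ?iR //; apply: (forall_inP a'z).
case iR: (i \in R); first exact: r'S.
by rewrite r'r ?inE ?iR //; apply: (forall_inP az).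
Qed.

(** A smaller certificate after fixing [i] would, with [i] added, be smaller than [R] before. *)
Lemma minimal_cert_upd r x R i : i \in R -> r i = None ->
  minimal_cert r x R -> minimal_cert (upd r i (Some (x i))) x (R :\ i).
Proof.
move=> iR ri [Rcert Rmin].
have fillE y : x i = y i -> fill (upd r i (Some (x i))) y = fill r y.
  move=> xy; apply/ffunP => j; rewrite !ffunE; case: eqP => // ->.
  by rewrite ri.
split=> [y xy | D DR].
  have -> : fill (upd r i (Some (x i))) y =
            fill r [ffun j => if j == i then x i else y j].
    by apply/ffunP => j; rewrite !ffunE; case: eqP => // ->; rewrite ri.
  apply: Rcert => j jR; rewrite ffunE.
  by case: (eqVneq j i) => [->//|ji]; rewrite xy // !inE ji.
have [|y xy fy] := Rmin (i |: D).
  rewrite properE subUset sub1set iR (subset_trans (proper_sub DR)) ?subsetDl //=.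
  apply: contra (proper_subn DR) => RD.
  by apply/subsetP => j; rewrite !inE => /andP[ji /(subsetP RD)]; rewrite !inE (negPf ji).
exists y => [j jD|]; first by rewrite xy // !inE jD orbT.
by rewrite fillE // xy // !inE eqxx.
Qed.

(** The induction continues with [r1], where [i] has its value in the certificate, while [r']
    finally gives [i] the value satisfying [z]. That [r'] does not falsify [z] is the invariant by
    which the decoder finds the terms; each of the [n] stars set contributes a factor [m]. *)
Lemma encode x n : forall r R z,
  {in R, forall i, r i = None} -> minimal_cert r x R -> (n <= #|R|)%N -> f z ->
  ((0 < n)%N -> exists2 i, i \in S z & i \in R) ->
  exists c r', [/\ size c = n, {in ~: R, r' =1 r},
    (forall i, i \in S z -> i \in R -> r' i != Some (~~ z i)),
    weight F m r' = m%:R ^+ n * weight F m r & decode r' z c = r].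
Proof.
elim: n => [|n IHn] r R z rR Rmin nR fz hits.
  by exists [::], r; split=> // [i iS iR|]; rewrite ?rR // mul1r.
have [//|i iS iR] := hits; have ri := rR i iR.
pose r1 := upd r i (Some (x i)).
have r1R : {in R :\ i, forall j, r1 j = None}.
  by move=> j; rewrite !inE ffunE => /andP[/negPf -> /rR].
have R1min := minimal_cert_upd iR ri Rmin.
have nR1 : (n <= #|R :\ i|)%N by move: nR; rewrite (cardsD1 i) iR.
pose e := ~~ [exists j in S z, j \in R :\ i].
(* For [n = 0] the term is kept: [R :\ i] may be empty, and then [first_alive r1] need not satisfy
   [f]. *)
pose z1 := if (0 < n)%N && e then first_alive r1 else z.
have R1_neq0 : (0 < n)%N -> R :\ i != set0.
  by move=> n0; rewrite -card_gt0 (leq_trans n0).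
have [fz1 hits1] : f z1 /\ ((0 < n)%N -> exists2 j, j \in S z1 & j \in R :\ i).
  rewrite /z1; case: (posnP n) => [_ | n0] //=.
  case: (boolP e) => [_ | /negPn/exists_inP[j jS jR]]; last by split=> //; exists j.
  by have [? _ ?] := first_alive_hits R1min (R1_neq0 n0).
have [c [r' [sc r'r r'S wr' dec]]] := IHn r1 _ z1 r1R R1min nR1 fz1 hits1.
have r'i : r' i = Some (x i) by rewrite r'r ?inE ?eqxx // ffunE eqxx.
have zw : (index i (enum (S z)) < w)%N.
  by apply: leq_trans (S_size fz); rewrite cardE index_mem mem_enum.
exists ((Ordinal zw, x i, e) :: c), (upd r' i (Some (z i))); split.
- by rewrite /= sc.
- move=> j; rewrite inE => jR; have /negPf ji : j != i.
    by apply: contraNneq jR => ->.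
  by rewrite ffunE ji r'r ?inE ?ji // ffunE ji.
- move=> j jS jR; rewrite ffunE; case: (eqVneq j i) => [->|ji].
    by case: (z i).
  have jR1 : j \in R :\ i by rewrite !inE ji.
  have ne : ~~ e by rewrite negbK; apply/exists_inP; exists j.
  by move: (r'S j); rewrite /z1 (negPf ne) andbF; apply.
- by rewrite (weight_upd_some _ _ _ r'i) wr' weight_upd // mulrA -exprSr.
rewrite /= nth_index ?mem_enum //.
(* The decoder puts the certificate value back at [i] before it looks for the next term. *)
have -> : upd (upd r' i (Some (z i))) i (Some (x i)) = r'.
  by apply/ffunP => j; rewrite !ffunE; case: eqP => // ->.
have -> : decode r' (if e then first_alive r' else z) c = r1.
  case: (posnP n) => [n0 | n0].
    by move: dec sc; rewrite n0; case: (c).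
  rewrite -dec /z1 n0 /=; case: (boolP e) => //= Pe; congr decode.
  apply: (first_alive_extend r1R R1min (R1_neq0 n0) r'r) => j.
  by move: (r'S j); rewrite /z1 n0 Pe; apply.
by apply/ffunP => j; rewrite !ffunE; case: eqP => // ->.
Qed.

End Switching.

(** At a point [x] without a certificate of size [w], the set of all coordinates shrinks to a
    minimal certificate; minimality discards the coordinates fixed by [r]. *)
Lemma minimal_cert_exists (T : finType) w (f : {ffun T -> bool} -> bool) r :
  ~~ cert false w (f \o fill r) ->
  exists x (R : {set T}), [/\ {in R, forall i, r i = None}, minimal_cert f r x R &
    (w < #|R|)%N].
Proof.
rewrite negb_forall => /existsP[x]; rewrite negb_imply => /andP[/eqP fx /existsPn noS].
pose P (A : {set T}) := cert_at false (f \o fill r) x A.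
have PP (A : {set T}) :
    reflect (forall y : {ffun T -> bool}, {in A, x =1 y} -> ~~ f (fill r y)) (P A).
  apply: (iffP forallP) => H y.
    by move=> /agreeP xy; have:= H y; rewrite xy /= => /eqP ->.
  by apply/implyP => /agreeP/H /negPf /= ->.
have PT : P setT.
  apply/PP => y xy; have -> : y = x by apply/ffunP => i; rewrite xy.
  by rewrite /= in fx; rewrite fx.
have [R /minsetP[/PP PR Rmin] _] := minset_exists PT.
exists x, R; split.
- move=> i iR; case ri: (r i) => [b|] //.
  have : P (R :\ i).
    apply/PP => y xy.
    have -> : fill r y = fill r [ffun j => if j == i then x i else y j].
      by apply/ffunP => j; rewrite !ffunE; case: eqP => // ->; rewrite ri.
    apply: PR => j jR; rewrite ffunE; case: (eqVneq j i) => [->|ji] //.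
    by rewrite xy // !inE ji.
  move=> /Rmin /(_ (subD1set _ _)) /setP/(_ i); rewrite !inE eqxx iR //.
- split=> // D DR.
  have : ~~ P D.
    apply/negP => /Rmin /(_ (proper_sub DR)) DRe; by rewrite DRe properxx in DR.
  rewrite negb_forall => /existsP[y]; rewrite negb_imply => /andP[/agreeP xy fy].
  by exists y => //; move: fy => /=; case: (f _).
- rewrite ltnNge; apply/negP => Rw; have := noS R.
  by rewrite Rw /=; move/PP: PR; rewrite /P => ->.
Qed.

Section SwitchingLemma.
Variables (F : realFieldType) (T : finType) (m w : nat).
Hypothesis m_gt0 : (0 < m)%N.

(** A bad restriction is recovered from one of (4w)^w codes and a restriction [m ^ w] times heavier;
    for each code the latter weigh at most 1 in total. *)
Lemma switching_true (f : {ffun T -> bool} -> bool) : cert true w f ->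
  \sum_(r | ~~ cert false w (f \o fill r)) weight F m r <= ((4 * w)%:R / m%:R) ^+ w.
Proof.
move=> /forallP cf; pose bad r := ~~ cert false w (f \o fill r).
pose S z := odflt set0 [pick A : {set T} | (#|A| <= w)%N && cert_at true f z A].
have SP z : f z -> (#|S z| <= w)%N && cert_at true f z (S z).
  move=> fz; rewrite /S; case: pickP => //= noA.
  by have /existsP[A] := implyP (cf z) (introT eqP fz); rewrite noA.
have S_size z : f z -> (#|S z| <= w)%N by move=> /SP /andP[].
have S_cert z (y : {ffun T -> bool}) : f z -> {in S z, z =1 y} -> f y.
  by move=> /SP /andP[_ /forallP/(_ y)/implyP H] /agreeP/H/eqP.
case: (pickP bad) => [r0 | nobad]; last first.
  by rewrite big_pred0 // exprn_ge0 // divr_ge0.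
(* A bad restriction has a nonempty certificate, which supplies the default [i0] of the decoder. *)
move=> /minimal_cert_exists[_ [R0 [_ _ /(leq_ltn_trans (leq0n _))]]].
rewrite card_gt0 => /set0Pn[i0 _].
pose dec (c : w.-tuple ('I_w * bool * bool)) r :=
  decode f S i0 r (first_alive f S r) c.
have enc r : bad r -> exists c r',
    (dec c r' == r) && (weight F m r' == m%:R ^+ w * weight F m r).
  move=> /minimal_cert_exists[x [R [rR Rmin /ltnW wR]]].
  case: (posnP w) => [w0 | w_gt0].
    rewrite /dec; move: (first_alive f S r) => z; rewrite w0.
    by exists [tuple], r; rewrite /= expr0 mul1r !eqxx.
  have Rn0 : R != set0 by rewrite -card_gt0 (leq_trans w_gt0).
  have [fz az hits] := first_alive_hits S_cert Rmin Rn0.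
  have [c [r' [/eqP sc r'r r'S wr' de]]] :=
    encode F m S_size S_cert i0 rR Rmin wR fz (fun=> hits).
  exists (Tuple sc), r'; rewrite wr' eqxx andbT /dec.
  by rewrite (first_alive_extend S_cert rR Rmin Rn0 r'r r'S) /= de.
have mw_gt0 : 0 < m%:R ^+ w :> F by rewrite exprn_gt0 // ltr0n.
rewrite expr_div_n ler_pdivlMr // mulr_suml.
have -> : (4 * w)%:R ^+ w =
    \sum_(c : w.-tuple ('I_w * bool * bool)) \sum_(r : {ffun T -> option bool})
       weight F m r :> F.
  under eq_bigr => c _ do rewrite sum_weight.
  rewrite sumr_const card_tuple !card_prod card_ord card_bool -natrX.
  by rewrite -mulnA mulnC.
under [leRHS]eq_bigr => c _ do rewrite (partition_big (dec c) predT) //=.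
rewrite exchange_big /= big_mkcond; apply: ler_sum => r _.
have ge0 c : 0 <= \sum_(r' | dec c r' == r) weight F m r'.
  by apply: sumr_ge0 => r' _; apply: weight_ge0.
case: ifP => [/enc[c [r' /andP[cr' /eqP wr']]] | _]; last exact: sumr_ge0.
rewrite (bigD1 c) //= (bigD1 r') //= mulrC -wr' -addrA ler_wpDr //.
by rewrite addr_ge0 ?sumr_ge0 // => *; apply: weight_ge0.
Qed.

Lemma switching b (f : {ffun T -> bool} -> bool) : cert b w f ->
  \sum_(r | ~~ cert (~~ b) w (f \o fill r)) weight F m r <= ((4 * w)%:R / m%:R) ^+ w.
Proof.
case: b => [|cf]; first exact: switching_true.
have := @switching_true (negb \o f); rewrite (certN false) => /(_ cf).
by under eq_bigl => r do rewrite -[comp _ _]/(fun x => ~~ (f \o fill r) x) (certN true).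
Qed.

End SwitchingLemma.

(** * Average sensitivity of circuits *)

Section Circuit.
Variables (T O : finType) (C : circuit T O).
Notation node := (T + gate C)%type.
Let wire : rel node := edge (@fanin _ _ C).
Implicit Types (V : node -> {ffun T -> bool} -> bool).

(* Unlike being the values of the nodes of [C], consistency is stable under
   restriction. *)
Definition consistent V := forall g x,
  V (inr g) x = match op g with
    | And => [forall u in fanin g, V u x]
    | Or => [exists u in fanin g, V u x]
    | Not => [exists u in fanin g, ~~ V u x]
    end.

Definition level k (u : node) := forall v s,
  path wire v s -> last v s = u -> (size s <= k)%N.

Definition two_cert w (f : {ffun T -> bool} -> bool) := cert true w f && cert false w f.

Lemma level_input k i : level k (inl i).
Proof.
move=> v s; case/lastP: s => // s u.
by rewrite rcons_path last_rcons => /andP[_ uv] uE; rewrite uE in uv.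
Qed.

Lemma level0_gate g : ~ level 0 (inr g).
Proof.
move=> l0; have /set0Pn[u ug] := fanin_neq0 g.
by have := l0 u [:: inr g]; rewrite /= ug => /(_ isT erefl).
Qed.

Lemma level_fanin k g u : level k.+1 (inr g) -> u \in fanin g -> level k u.
Proof.
move=> lg ug v s vs su; have := lg v (rcons s (inr g)).
by rewrite rcons_path last_rcons size_rcons vs su /= ug => /(_ isT erefl).
Qed.

Lemma consistent_fill V r : consistent V -> consistent (fun u => V u \o fill r).
Proof. by move=> cV g x; apply: cV. Qed.

(** One input decides: a false one certifies that an And is false or a Not true, a true one that an
    Or is true. The other value of an And or Or may depend on all inputs and is left to the
    switching lemma. *)
Lemma cert_gate w V g : consistent V ->
  (forall u, u \in fanin g -> two_cert w (V u)) -> exists b, cert b w (V (inr g)).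
Proof.
move=> cV cw; case E: (op g).
- exists false; apply/certP => x; rewrite cV E => /negbT.
  rewrite negb_forall_in => /exists_inP[u ug /negbTE Vu].
  have /andP[_ /certP/(_ _ Vu)[S wS HS]] := cw u ug; exists S => // y /HS Vy.
  rewrite cV E; apply/negbTE; rewrite negb_forall_in.
  by apply/exists_inP; exists u; rewrite // Vy.
- exists true; apply/certP => x; rewrite cV E => /exists_inP[u ug Vu].
  have /andP[/certP/(_ _ Vu)[S wS HS] _] := cw u ug; exists S => // y /HS Vy.
  by rewrite cV E; apply/exists_inP; exists u; rewrite // Vy.
- exists true; apply/certP => x; rewrite cV E => /exists_inP[u ug /negbTE Vu].
  have /andP[_ /certP/(_ _ Vu)[S wS HS]] := cw u ug; exists S => // y /HS Vy.
  by rewrite cV E; apply/exists_inP; exists u; rewrite // Vy.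
Qed.

Definition switch_fails w V r :=
  [exists g : gate C, [exists b, cert b w (V (inr g)) &&
     ~~ two_cert w (V (inr g) \o fill r)]].

(** Union bound over the gates: certificates for [b] survive every restriction, and those for [~~ b]
    fail with weight at most (4w / 8w)^w. *)
Lemma switch_fails_weight (F : realFieldType) w V : (0 < w)%N ->
  \sum_(r | switch_fails w V r) weight F (8 * w) r <= #|gate C|%:R / 2 ^+ w.
Proof.
move=> w0; pose B g r :=
  [exists b, cert b w (V (inr g)) && ~~ two_cert w (V (inr g) \o fill r)].
apply: (@le_trans _ _ (\sum_(g : gate C) \sum_(r | B g r) weight F (8 * w) r)).
  under [leRHS]eq_bigr => g _ do rewrite big_mkcond.
  rewrite exchange_big /= big_mkcond; apply: ler_sum => r _.
  have ge0 g : 0 <= (if B g r then weight F (8 * w) r else 0).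
    by case: ifP => // _; apply: weight_ge0.
  case: ifP => [/existsP[g Bg] | _]; last exact: sumr_ge0.
  rewrite (bigD1 g) //= /B Bg ler_wpDr //; apply: sumr_ge0 => h _; exact: ge0.
rewrite mulr_natl -sumr_const; apply: ler_sum => g _.
case: (boolP [exists b, cert b w (V (inr g))]) => [/existsP[b cb] | nob]; last first.
  rewrite big_pred0 ?invr_ge0 ?exprn_ge0 // => r.
  apply/negbTE; apply: contra nob => /existsP[b /andP[cb _]].
  by apply/existsP; exists b.
apply: (@le_trans _ _ (\sum_(r | ~~ cert (~~ b) w (V (inr g) \o fill r))
    weight F (8 * w) r)).
  rewrite big_mkcond [leRHS]big_mkcond; apply: ler_sum => r _.
  case: ifP => [/existsP[b' /andP[_ nc]] | _]; last by case: ifP => // _; apply: weight_ge0.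
  have cbr := cert_fill r cb; case: ifP => // /negbFE cnb.
  by case/negP: nc; rewrite /two_cert; case: (b) cbr cnb => /= -> ->.
apply: le_trans (switching F _ cb) _; first by rewrite muln_gt0.
rewrite -exprVn; have -> // : (4 * w)%:R / (8 * w)%:R = 2^-1 :> F.
have : w%:R != 0 :> F by rewrite pnatr_eq0 -lt0n.
by rewrite !natrM => ?; field.
Qed.

(** Induction on the number [j] of levels still to be switched, each by a restriction with
    [m = 8 * w]. If no gate fails, level [k.+1] gets certificates for both values; the failures
    contribute at most 1 to the expected average sensitivity, by [small]. *)
Lemma boundary_level w (w_gt0 : (0 < w)%N) : (#|gate C| * #|T| <= 2 ^ w)%N ->
  forall j k V, consistent V -> (forall u, level k u -> two_cert w (V u)) ->
  forall u, level (k + j).+1 u ->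
  (boundary (V u) <= #|{ffun T -> bool}| * ((34 * w) ^ j * (2 * w)))%N.
Proof.
move=> small; have gate_one_cert k V g : consistent V ->
    (forall u, level k u -> two_cert w (V u)) -> level k.+1 (inr g) ->
    exists b, cert b w (V (inr g)).
  by move=> cV cw lg; apply: cert_gate => // u /(level_fanin lg); apply: cw.
elim=> [|j IHj] k V cV cw u lu.
  rewrite mul1n; case: u lu => [i | g] lu.
    by have /andP[+ _] := cw _ (@level_input k i); apply: boundary_cert.
  by rewrite addn0 in lu; have [b] := gate_one_cert k V g cV cw lu; apply: boundary_cert.
set M := #|{ffun T -> bool}|; set B := ((34 * w) ^ j * (2 * w))%N in IHj *.
have good r : ~~ switch_fails w V r -> (boundary (V u \o fill r) <= M * B)%N.
  move=> /existsPn ok; apply: (IHj k.+1 (fun u => V u \o fill r)).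
  - exact: consistent_fill.
  - case=> [i _ | g lg].
      by have /andP[? ?] := cw _ (@level_input k i); rewrite /two_cert !cert_fill.
    have [b cb] := gate_one_cert k V g cV cw lg.
    by apply: contraNT (ok g) => nc; apply/existsP; exists b; rewrite cb.
  - by rewrite addSnnS.
have key : (boundary (V u))%:R / (2 * (8 * w) + 1)%:R <= (M * (B + 1))%:R :> rat.
  rewrite -sum_boundary_fill (bigID (switch_fails w V)) /= addrC mulnDr natrD muln1.
  apply: lerD.
    apply: (@le_trans _ _ (\sum_(r | ~~ switch_fails w V r)
      weight _ (8 * w) r * (M * B)%:R)).
      by apply: ler_sum => r /good ?; rewrite ler_wpM2l ?weight_ge0 ?ler_nat.
    rewrite -mulr_suml -[leRHS]mul1r ler_wpM2r // -(sum_weight _ T (8 * w)).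
    rewrite [leRHS](bigID (switch_fails w V)) /= ler_wpDl // sumr_ge0 // => r _.
    exact: weight_ge0.
  apply: (@le_trans _ _ (\sum_(r | switch_fails w V r)
    weight _ (8 * w) r * (M * #|T|)%:R)).
    by apply: ler_sum => r _; rewrite ler_wpM2l ?weight_ge0 ?ler_nat ?boundary_le.
  rewrite -mulr_suml.
  apply: le_trans (ler_wpM2r _ (switch_fails_weight _ _ w_gt0)) _ => //.
  rewrite mulrAC ler_pdivrMr ?exprn_gt0 // -natrX -!natrM ler_nat.
  by rewrite mulnCA leq_mul2l small orbT.
have B_gt0 : (0 < B)%N by rewrite muln_gt0 expn_gt0 !muln_gt0 w_gt0.
rewrite ler_pdivrMr ?ltr0n ?addn1 // -natrM ler_nat in key.
apply: (leq_trans key); rewrite expnS -mulnA -/B -mulnA leq_mul2l; apply/orP; right.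
(* As [B] and [w] are positive, [B + 1 <= 2 * B] and [16 * w + 1 <= 17 * w]; hence the constant
   34. *)
nia.
Qed.

(** Only [d] of the [d.+1] levels are switched: at the last one, certificates for one value suffice
    for [boundary_cert]. *)
Lemma boundary_circuit d w o : (0 < w)%N -> (#|gate C| * #|T| <= 2 ^ w)%N ->
  (circuit_depth C <= d.+1)%N ->
  (boundary (fun x => circuit_eval C x o) <=
     #|{ffun T -> bool}| * ((34 * w) ^ d * (2 * w)))%N.
Proof.
move=> w_gt0 small /circuit_depthP dC.
pose V u x := node_value x (gate_value C x) u.
have cV : consistent V.
  by move=> g x; have /ffunP/(_ g) := proj2 (gate_valueP x (gate_value C x)) erefl;
    rewrite ffunE => /esym.
have -> : boundary (fun x => circuit_eval C x o) = boundary (V (output C o)).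
  by rewrite !boundaryE; under eq_bigr => x _ do under eq_bigr => i _ do rewrite !ffunE.
apply: (@boundary_level w w_gt0 small d 0) => //; last by move=> v s vs _; apply: dC vs.
(* Level 0 consists of the inputs, each certified by its own singleton. *)
case=> [i _ | g /level0_gate//].
by apply/andP; split; apply/certP => x /= xi; exists [set i]; rewrite ?cards1 // => y <-;
  rewrite ?inE.
Qed.

End Circuit.

(** * Avoiding the bad edges of a path *)

Section Path.
Variables (F : realFieldType) (T : finType).
Variable e : rel {ffun T -> bool}.
Implicit Types (J : {ffun T -> bool}) (i : T) (s : seq T).

Definition set_bit J (ib : T * bool) : {ffun T -> bool} :=
  [ffun i => if i == ib.1 then ib.2 else J i].

Fixpoint avoids J (ibs : seq (T * bool)) :=
  if ibs is ib :: ibs' then ~~ e J (set_bit J ib) && avoids (set_bit J ib) ibs'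
  else true.

(** For irreflexive [e], the probability that resampling the coordinates of [s] in turn from [J]
    crosses no edge of [e]: each bit stays or flips with equal chance. *)
Fixpoint avoid_prob s J : F :=
  if s is i :: s' then
    (avoid_prob s' J + (~~ e J (flip i J))%:R * avoid_prob s' (flip i J)) / 2
  else 1.

Lemma set_bitE J i b : set_bit J (i, b) = if b == J i then J else flip i J.
Proof.
case: (eqVneq b (J i)) => [->|nb]; apply/ffunP => j; rewrite !ffunE /=.
  by case: eqP => // ->.
by case: eqP => // ->; case: b nb; case: (J i).
Qed.

Lemma avoidsP J ibs :
  avoids J ibs =
  [forall t : 'I_(size ibs), ~~ e (foldl set_bit J (take t ibs))
                                  (foldl set_bit J (take t.+1 ibs))].
Proof.
elim: ibs J => [|ib ibs IHibs] J /=; first by apply/esym/forallP => -[].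
rewrite IHibs; apply/andP/forallP => [[e0 /forallP e1] [[|t] /= lt] | H].
- by rewrite take0.
- exact: (e1 (Ordinal (lt : t < size ibs)%N)).
- split; first by have := H ord0; rewrite /= take0.
  by apply/forallP => t; have := H (lift ord0 t).
Qed.

Hypothesis e_irrefl : forall J, ~~ e J J.

Lemma card_avoids s J m : size s = m ->
  #|[set X : m.-tuple bool | avoids J (zip s X)]|%:R = 2 ^+ m * avoid_prob s J.
Proof.
elim: s J m => [|i s IHs] J [|m] //= => [_ | [sm]].
  rewrite mul1r (_ : [set X | _] = setT) ?cardsT ?card_tuple //.
  by apply/setP => X; rewrite !inE tuple0.
have E : #|[set X : m.+1.-tuple bool | avoids J (zip (i :: s) X)]| =
   (\sum_b #|[set X : m.-tuple bool | avoids J (zip (i :: s) (b :: X))]|)%N.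
  rewrite -sum1_card big_mkcond /=.
  rewrite (reindex (fun p : bool * m.-tuple bool => [tuple of p.1 :: p.2])) /=.
    rewrite -(pair_bigA _ (fun b (X : m.-tuple bool) =>
      if [tuple of b :: X] \in _ then 1 else 0)%N) /=.
    apply: eq_bigr => b _; rewrite -sum1_card [RHS]big_mkcond; apply: eq_bigr => X _.
    by rewrite !inE.
  exists (fun X => (thead X, [tuple of behead X])) => [[b X] _ | X _] /=.
    by rewrite theadE; congr pair; apply: val_inj.
  by rewrite [RHS]tuple_eta; apply: val_inj.
rewrite E big_bool natrD exprS.
have Eb b : #|[set X : m.-tuple bool | avoids J (zip (i :: s) (b :: X))]|%:R =
   (~~ e J (set_bit J (i, b)))%:R * (2 ^+ m * avoid_prob s (set_bit J (i, b))).
  rewrite -IHs //=; case: (e J _) => /=; last by rewrite mul1r.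
  by rewrite mul0r (_ : [set X | _] = set0) ?cards0 //; apply/setP => X; rewrite !inE.
rewrite !Eb !set_bitE; have := e_irrefl J; by case: (J i) => /= /negPf -> /=; field.
Qed.

Lemma avoid_prob_gt0 s J : 0 < avoid_prob s J.
Proof.
elim: s J => //= i s IHs J; rewrite divr_gt0 // ltr_wpDr // mulr_ge0 //.
exact: ltW.
Qed.

Hypothesis e_sym : symmetric e.

Definition bad_flips i := #|[set J | e J (flip i J)]|.

(* When the edge is bad the walk stays, and the factor [2^-1] is the only
   loss; otherwise AM-GM applies, and the involution that flips along the good
   edges shows that on the geometric mean nothing is lost. *)
Lemma prod_avoid_prob s :
  2^-1 ^+ (\sum_(i <- s) bad_flips i)%N <= \prod_J avoid_prob s J.
Proof.
elim: s => [|i s IHs]; first by rewrite big_nil big1.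
rewrite big_cons exprD; set h := avoid_prob s in IHs *.
set h' := avoid_prob (i :: s).
have h_gt0 J : 0 < h J by apply: avoid_prob_gt0.
have h'_gt0 J : 0 < h' J by apply: avoid_prob_gt0.
pose b J := e J (flip i J); pose phi J := if b J then J else flip i J.
have bflip J : b (flip i J) = b J by rewrite /b flipK e_sym.
have phiK : involutive phi.
  by move=> J; rewrite /phi; case E: (b J); rewrite ?E // bflip E flipK.
have ph : \prod_J h (phi J) = \prod_J h J.
  by rewrite [RHS](reindex_inj (inv_inj phiK)).
(* AM-GM is used in squared form, to avoid square roots. *)
have step J : (2^-1 ^+ b J) ^+ 2 * (h J * h (phi J)) <= h' J ^+ 2.
  rewrite /h' /= -/h /phi -/(b J); case: (b J) => /=.
    by rewrite mul0r addr0 expr1 -expr2 -exprMn mulrC.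
  rewrite expr0 expr1n !mul1r; set u := h J; set v := h _.
  rewrite -subr_ge0 (_ : _ - _ = ((u - v) / 2) ^+ 2) ?sqr_ge0 //.
  by field.
have E : \prod_J 2^-1 ^+ b J = 2^-1 ^+ bad_flips i :> F.
  rewrite -expr_sum /bad_flips -sum1_card [in RHS]big_mkcond /=; congr (_ ^+ _).
  by apply: eq_bigr => J _; rewrite inE -/(b J); case: (b J).
apply: (@le_trans _ _ (2^-1 ^+ bad_flips i * \prod_J h J)).
  by apply: ler_wpM2l IHs; rewrite exprn_ge0 // invr_ge0.
have p_ge0 (g : {ffun T -> bool} -> F) : (forall J, 0 < g J) -> 0 <= \prod_J g J.
  by move=> g0; apply: prodr_ge0 => J _; apply: ltW.
rewrite -(@ler_pXn2r _ 2) // ?nnegrE ?mulr_ge0 ?exprn_ge0 ?p_ge0 ?invr_ge0 //.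
rewrite exprMn [X in _ * X]expr2 -{2}ph -E -!prodrXl -!big_split /=.
apply: ler_prod => J _; rewrite step andbT mulr_ge0 ?exprn_ge0 ?invr_ge0 //.
by rewrite mulr_ge0 // ltW.
Qed.

End Path.

Section PathBound.
Variables (R : realType) (T : finType).
Variable e : rel {ffun T -> bool}.
Hypothesis e_sym : symmetric e.

(** The mean over [J] is at least the geometric mean, which [prod_avoid_prob] bounds. No direction
    repeats in [s], so the exponent there is at most the total number of bad flips; finally 1 / 2 >=
    1 / e. *)
Lemma sum_avoid_prob s (B : R) : uniq s ->
  (\sum_i bad_flips e i)%:R <= #|{ffun T -> bool}|%:R * B ->
  #|{ffun T -> bool}|%:R * expR (- B) <= \sum_J avoid_prob R e s J.
Proof.
move=> us sB; set M := #|{ffun T -> bool}| in sB *.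
have M_gt0 : (0 < M)%N by apply/card_gt0P; exists [ffun=> true].
have MR : 0 < M%:R :> R by rewrite ltr0n.
rewrite mulrC -ler_pdivlMr //; set a := _ / _.
have a_ge0 : 0 <= a.
  by rewrite divr_ge0 // sumr_ge0 // => J _; rewrite ltW // avoid_prob_gt0.
rewrite -(@ler_pXn2r _ M) // ?nnegrE ?expR_ge0 //.
have -> : expR (- B) ^+ M = expR (- (M%:R * B)) by rewrite -expRM_natl mulrN.
have agm : \prod_J avoid_prob R e s J <= a ^+ M.
  have [+ _] := @leif_AGM R _ [set: {ffun T -> bool}] (avoid_prob R e s)
    (fun J _ => ltW (avoid_prob_gt0 R e s J)).
  rewrite /a /M -cardsT; congr (_ <= (_ / _) ^+ _); by apply: eq_bigl => J; rewrite inE.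
apply: le_trans agm; apply: le_trans (prod_avoid_prob R e_sym s).
apply: (@le_trans _ _ (expR (- (\sum_(i <- s) bad_flips e i)%:R))).
  rewrite ler_expR lerN2; apply: le_trans sB; rewrite ler_nat.
  rewrite big_uniq //= [leqRHS](bigID (mem s)) /= leq_addr //.
rewrite -[X in - X]mulr1 -mulrN expRM_natl lerXn2r ?nnegrE ?expR_ge0 ?invr_ge0 //.
rewrite expRN lef_pV2 ?posrE ?expR_gt0 //.
by apply: le_trans (expR_ge1Dx 1).
Qed.

End PathBound.

(** * Bad pairs on the interpolation path of a circuit *)

Section Interpolation.
Variables (R : realType) (p n : nat) (C : circuit (multi_index n p) 'I_n).
Variable kappa : R.
Hypotheses (n_gt0 : (0 < n)%N) (kappa_gt0 : 0 < kappa).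
Local Notation T := (multi_index n p).

Lemma card_multi_index : #|multi_index n p| = (n ^ p)%N.
Proof. by rewrite card_tuple card_ord. Qed.

Lemma sqdistE (x y : {ffun 'I_n -> bool}) :
  sqdist R x y = 4 * (\sum_o (x o != y o))%:R.
Proof.
rewrite natr_sum mulr_sumr; apply: eq_bigr => o _.
by case: (x o); case: (y o); rewrite /spin /=; ring.
Qed.

Lemma bad_irrefl (J : tensor n p) : ~~ bad C kappa J J.
Proof.
rewrite /bad sqdistE big1 => [|o _]; last by rewrite eqxx.
by rewrite mulr0 negb_and -ltNge mulr_gt0 ?orbT // ltr0n.
Qed.

Lemma bad_sym : symmetric (bad C kappa).
Proof.
move=> J1 J2; rewrite /bad !sqdistE; congr andb.
  by congr (_ <= _)%N; apply: eq_card => i; rewrite !inE eq_sym.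
by congr (_ <= 4 * _%:R); apply: eq_bigr => o _; rewrite eq_sym.
Qed.

(** A bad flip changes at least [kappa * n / 4] outputs, since each changed output adds 4 to
    [sqdist]. *)
Lemma sum_bad_flips :
  kappa * n%:R * (\sum_i bad_flips (bad C kappa) i)%:R <=
  4 * (\sum_o boundary (fun J => circuit_eval C J o))%:R.
Proof.
have -> : (\sum_o boundary (fun J => circuit_eval C J o) =
    \sum_i \sum_J \sum_o (circuit_eval C J o != circuit_eval C (flip i J) o))%N.
  under eq_bigr => o _ do rewrite boundaryE exchange_big /=.
  rewrite exchange_big /=; apply: eq_bigr => i _.
  by rewrite exchange_big.
rewrite !natr_sum !mulr_sumr; apply: ler_sum => i _.
rewrite /bad_flips -sum1_card !natr_sum big_mkcond !mulr_sumr /=; apply: ler_sum => J _.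
rewrite inE -sqdistE; case: ifP => [/andP[_]|_]; first by rewrite mulr1.
by rewrite mulr0 sqdistE mulr_ge0.
Qed.

Lemma no_bad_pairE (w : sample n p) :
  (w \in no_bad_pair C kappa) = avoids (bad C kappa) w.1.1 (zip (val w.1.2) w.2).
Proof.
case: w => [[J s] X]; rewrite inE avoidsP /=.
have sz : size (zip (val s) X) = (n ^ p)%N by rewrite size_zip !size_tuple minnn.
by move: (size _) sz => k ->.
Qed.

Lemma card_no_bad_pair :
  #|no_bad_pair C kappa|%:R =
  \sum_(s : ordering n p) \sum_J 2 ^+ (n ^ p) * avoid_prob R (bad C kappa) (val s) J.
Proof.
have -> : #|no_bad_pair C kappa| =
    (\sum_Js \sum_X if (Js, X) \in no_bad_pair C kappa then 1 else 0)%N.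
  by rewrite -sum1_card big_mkcond pair_bigA; apply: eq_bigr => -[Js X].
rewrite [RHS]exchange_big [RHS]pair_big /=.
rewrite natr_sum; apply: eq_bigr => -[J s] _ /=.
rewrite -(card_avoids _ bad_irrefl) ?size_tuple // -sum1_card [in RHS]big_mkcond /=.
by congr _%:R; apply: eq_bigr => X _; rewrite no_bad_pairE inE.
Qed.

Lemma ordering_gt0 : (0 < #|ordering n p|)%N.
Proof.
have sz : size (enum T) = (n ^ p)%N by rewrite -cardE card_multi_index.
apply/card_gt0P; have u : uniq (tcast sz (in_tuple (enum T))).
  by rewrite val_tcast enum_uniq.
by exists (exist (fun s : (n ^ p).-tuple T => uniq s) _ u).
Qed.

(** The bound holds for every fixed order, hence for a random one; summing over the [n] outputs
    cancels the [n] in the threshold [kappa * n]. *)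
Lemma prob_no_bad_pair (B : R) :
  (forall o, (boundary (fun J => circuit_eval C J o))%:R <= #|tensor n p|%:R * B) ->
  expR (- (4 / kappa * B)) <= prob R (no_bad_pair C kappa).
Proof.
move=> CB; have M_gt0 : 0 < #|tensor n p|%:R :> R.
  by rewrite ltr0n; apply/card_gt0P; exists [ffun=> true].
have nR : 0 < n%:R :> R by rewrite ltr0n.
have sB : (\sum_i bad_flips (bad C kappa) i)%:R <= #|tensor n p|%:R * (4 / kappa * B).
  rewrite -(ler_pM2l (mulr_gt0 kappa_gt0 nR)); apply: le_trans sum_bad_flips _.
  rewrite (_ : _ * (_ * _) = 4 * (n%:R * (#|tensor n p|%:R * B))); last first.
    by field; rewrite gt_eqF.
  rewrite ler_pM2l // natr_sum mulr_natl -[X in _ *+ X]card_ord -sumr_const.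
  exact: ler_sum.
rewrite /prob card_no_bad_pair ler_pdivlMr; last first.
  rewrite ltr0n !card_prod !muln_gt0 ordering_gt0 card_tuple card_bool expn_gt0 !andbT.
  by move: M_gt0; rewrite ltr0n.
apply: (@le_trans _ _ (\sum_(s : ordering n p)
    2 ^+ (n ^ p) * (#|tensor n p|%:R * expR (- (4 / kappa * B))))).
  rewrite sumr_const !card_prod card_tuple card_bool !natrM natrX -[leRHS]mulr_natl.
  by rewrite le_eqVlt; apply/orP; left; apply/eqP; ring.
apply: ler_sum => s _; rewrite -mulr_sumr ler_pM2l ?exprn_gt0 //.
exact: (sum_avoid_prob bad_sym (valP s) sB).
Qed.

End Interpolation.

(** * Choice of the parameters for large [n] *)

Lemma ln_eventually_ge (R : realType) (K : R) :
  exists N : nat, forall n, (N <= n)%N -> K <= ln (n%:R : R).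
Proof.
exists (Num.trunc (expR K)).+1 => n Nn.
rewrite -[K]expRK ler_ln ?posrE ?expR_gt0 // ?ltr0n ?(leq_trans _ Nn) //.
by apply: ltW; apply: lt_le_trans (truncnS_gt _) _; rewrite ler_nat.
Qed.

Theorem theorem4 (R : realType) (p : nat) (alpha kappa rho : R)
    (d : nat -> nat) :
  (4 <= p)%N -> ~~ odd p ->
  0 < alpha -> 0 < kappa -> 0 < rho < 1 ->
  (forall n, (0 < d n)%N) ->
  exists N : nat, forall n : nat, (N <= n)%N ->
    forall C : circuit (multi_index n p) 'I_n,
      circuit_class (n%:R `^ alpha) (d n) rho C ->
      expR (- (ln n%:R `^ (12 / 10 * (d n)%:R))) <=
        prob R (no_bad_pair C kappa).
Proof.
move=> _ _ alpha_gt0 kappa_gt0 _ d_gt0.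
(* [A * L] will bound the width [w]; the summand 1 pays for rounding up, as [L >= 1]. *)
pose A : R := (alpha + p%:R) / ln 2 + 1.
have ln2_gt0 : 0 < ln 2 :> R by rewrite ln_gt0 ?ltr1n.
have c_ge0 : 0 <= (alpha + p%:R) / ln 2.
  by rewrite divr_ge0 ?(ltW ln2_gt0) // addr_ge0 // ltW.
have A_ge1 : 1 <= A by rewrite /A lerDr.
pose K := (1 + 4 / kappa) * (34 * A).
have K4_ge1 : 1 <= 1 + 4 / kappa by rewrite lerDl divr_ge0 // ltW.
have K_ge1 : 1 <= K by rewrite /K mulr_ege1 //; lra.
have K_ge0 : 0 <= K by apply: le_trans K_ge1.
(* The power is 5 because 12 / 10 = 1 + 1 / 5: once K <= L^(1/5), the factor [K] per level is
   absorbed by the exponent. *)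
have [N HN] := ln_eventually_ge (K ^+ 5).
exists (maxn 1 N) => n; rewrite geq_max => /andP[n_gt0 Nn] C [sizeC depthC _].
set L := ln n%:R; have KL : K ^+ 5 <= L by apply: HN.
have L_ge1 : 1 <= L by apply: le_trans KL; rewrite exprn_ege1.
have L_gt0 : 0 < L by apply: lt_le_trans L_ge1.
have nR : 0 < n%:R :> R by rewrite ltr0n.
(* This makes 2^w at least n^alpha times n^p, which bounds gates times inputs; the successor rounds
   up and makes [w] positive. *)
pose w := (Num.trunc ((alpha + p%:R) / ln 2 * L)).+1.
have wA : w%:R <= A * L.
  rewrite /w -natr1 [leRHS]mulrDl mul1r lerD // truncn_le //.
  by rewrite mulr_ge0 // ltW.
have small : (#|gate C| * #|multi_index n p| <= 2 ^ w)%N.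
  rewrite -(ler_nat R) card_multi_index natrM !natrX.
  apply: (@le_trans _ _ (n%:R `^ (alpha + p%:R))).
    rewrite powRD; last by rewrite (gt_eqF nR) implybT.
    by rewrite -powR_mulrn ?ler_wpM2r ?powR_ge0 // ltW.
  rewrite /powR gt_eqF // -powR_mulrn // /powR gt_eqF // ler_expR.
  by rewrite -ler_pdivrMr // mulrAC ltW // truncnS_gt.
case: (d n) (d_gt0 n) depthC => // d' _ depthC.
have CB o := @boundary_circuit _ _ C d' w o (ltn0Sn _) small depthC.
have CB' o : (boundary (fun J => circuit_eval C J o))%:R <=
    #|tensor n p|%:R * (34 * A * L) ^+ d'.+1.
  apply: (@le_trans _ _ (#|tensor n p|%:R * ((34 * w) ^ d' * (2 * w))%:R)).
    by rewrite -natrM ler_nat; apply: CB.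
  (* As [2 * w <= 34 * w], the last level counts as one more factor. *)
  rewrite ler_wpM2l //; apply: (@le_trans _ _ ((34 * w)%:R ^+ d'.+1)).
    by rewrite -natrX ler_nat expnSr leq_mul2l leq_mul2r !orbT.
  rewrite lerXn2r ?nnegrE ?mulr_ge0 ?(ltW L_gt0) ?(le_trans ler01 A_ge1) //.
  by rewrite natrM -mulrA ler_wpM2l.
apply: le_trans (prob_no_bad_pair n_gt0 kappa_gt0 CB').
rewrite ler_expR lerN2.
apply: (@le_trans _ _ ((K * L) ^+ d'.+1)).
  have -> : K * L = (1 + 4 / kappa) * (34 * A * L) by rewrite /K !mulrA.
  rewrite [leRHS]exprMn ler_wpM2r ?exprn_ge0 ?mulr_ge0 ?(ltW L_gt0)
    ?(le_trans ler01 A_ge1) //.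
  (* Being at least 1, [1 + 4 / kappa] is bounded by its own power [d'.+1]. *)
  apply: (@le_trans _ _ (1 + 4 / kappa)); first by rewrite lerDr.
  by rewrite -[leLHS]expr1 ler_weXn2l.
rewrite powRrM powR_mulrn ?powR_ge0 // lerXn2r ?nnegrE ?powR_ge0 //.
  by nra.
have K5 : K <= L `^ (2 / 10).
  have -> : K = (K ^+ 5) `^ (2 / 10).
    rewrite -powR_mulrn // -powRrM (_ : 5%:R * (2 / 10) = 1); last by field.
    by rewrite powRr1.
  by rewrite ge0_ler_powR ?divr_ge0 ?nnegrE ?exprn_ge0 ?(ltW L_gt0).
have -> : 12 / 10 = 2 / 10 + 1 :> R by field.
rewrite powRD; last by rewrite (gt_eqF L_gt0) implybT.
by rewrite powRr1 ?(ltW L_gt0) // ler_wpM2r // ltW.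
Qed.
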